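(* Let $E$ be a nonzero reflexive real Banach space and let $S\colon E\rightrightarrows E^*$ and $T\colon E^*\rightrightarrows E$ be maximally monotone. Suppose that either (i) $\pi_1\,\mathrm{dom}\,\varphi_T=E^*$ and there exists $w^*\in E^*$ with $E\times\{w^*\}\subset\mathrm{dom}\,\varphi_S$, or (ii) $\pi_1\,\mathrm{dom}\,\varphi_S=E$ and there exists $w\in E$ with $E^*\times\{w\}\subset\mathrm{dom}\,\varphi_T$. Then $(I_E+TS)(E)=E$.
   Context: Since $E$ is reflexive, $T$ is regarded as a multifunction from $E^*$ into $E=E^{**}$, with graph $G(T)\subset E^*\times E$; monotonicity of $T$ means $\langle t_1-t_2,t_1^*-t_2^*\rangle\ge0$ for $(t_1^*,t_1),(t_2^*,t_2)\in G(T)$. Fitzpatrick functions: $\varphi_S(x,x^* ):=\sup_{(s,s^* )\in G(S)}[\langle x,s^*\rangle+\langle s,x^*\rangle-\langle s,s^*\rangle]$ on $E\times E^*$, and $\varphi_T(x^*,x):=\sup_{(t^*,t)\in G(T)}[\langle x,t^*\rangle+\langle t,x^*\rangle-\langle t,t^*\rangle]$ on $E^*\times E$; $\mathrm{dom}$ is the set where the function is finite and $\pi_1$ the first-coordinate projection. $TSx:=\bigcup_{y^*\in Sx}Ty^*$, $(I_E+TS)x:=\{x+z\colon z\in TSx\}$, $(I_E+TS)(E):=\bigcup_{x\in E}(I_E+TS)x$. *)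

(* Defs.v *)
From HB Require Import structures.
From mathcomp Require Import all_boot all_order all_algebra.
From mathcomp Require Import all_classical all_reals all_analysis.
Set Implicit Arguments. Unset Strict Implicit. Unset Printing Implicit Defensive.
Import Order.TTheory GRing.Theory Num.Theory.
Import numFieldNormedType.Exports.
Local Open Scope classical_set_scope.
Local Open Scope ring_scope.

Section Duality.
Variables (R : realType) (E F : normedModType R).

Definition cont_lin_functional (V : normedModType R) (f : V -> R) : Prop :=
  (forall (a : R) (u v : V), f (a *: u + v) = a * f u + f v) /\ continuous f.

(* [pair] is a bilinear pairing E x F -> R that identifies F with the
   (continuous) dual E^* : every continuous linear functional on E is
   represented by a unique element of F, and the norm of F is the dual norm. *)
Definition is_dual_pairing (pair : E -> F -> R) : Prop :=
  [/\ (forall (a : R) (x1 x2 : E) (y : F),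
         pair (a *: x1 + x2) y = a * pair x1 y + pair x2 y),
      (forall (a : R) (x : E) (y1 y2 : F),
         pair x (a *: y1 + y2) = a * pair x y1 + pair x y2),
      (forall f : E -> R, cont_lin_functional f ->
         exists y : F, (forall x, f x = pair x y) /\
           forall y' : F, (forall x, f x = pair x y') -> y' = y) &
      (forall y : F,
         `|y| = sup [set `|pair x y| | x in [set x : E | `|x| <= 1]])].

Definition reflexive_pairing (pair : E -> F -> R) : Prop :=
  forall g : F -> R, cont_lin_functional g ->
    exists x : E, forall y, g y = pair x y.

Definition monotoneS (pair : E -> F -> R) (S : E -> set F) : Prop :=
  forall x1 x2 y1 y2, S x1 y1 -> S x2 y2 -> 0 <= pair (x1 - x2) (y1 - y2).

Definition max_monotoneS (pair : E -> F -> R) (S : E -> set F) : Prop :=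
  monotoneS pair S /\
  forall S' : E -> set F, monotoneS pair S' ->
    (forall x y, S x y -> S' x y) -> forall x y, S' x y -> S x y.

Definition monotoneT (pair : E -> F -> R) (T : F -> set E) : Prop :=
  forall y1 y2 x1 x2, T y1 x1 -> T y2 x2 -> 0 <= pair (x1 - x2) (y1 - y2).

Definition max_monotoneT (pair : E -> F -> R) (T : F -> set E) : Prop :=
  monotoneT pair T /\
  forall T' : F -> set E, monotoneT pair T' ->
    (forall y x, T y x -> T' y x) -> forall y x, T' y x -> T y x.

Definition fitzS (pair : E -> F -> R) (S : E -> set F) (x : E) (xs : F)
  : \bar R :=
  ereal_sup [set (pair x p.2 + pair p.1 xs - pair p.1 p.2)%:E
            | p in [set p : E * F | S p.1 p.2]].

Definition fitzT (pair : E -> F -> R) (T : F -> set E) (xs : F) (x : E)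
  : \bar R :=
  ereal_sup [set (pair x p.1 + pair p.2 xs - pair p.2 p.1)%:E
            | p in [set p : F * E | T p.1 p.2]].

Definition domS (pair : E -> F -> R) (S : E -> set F) : set (E * F) :=
  [set p | fitzS pair S p.1 p.2 \is a fin_num].
Definition domT (pair : E -> F -> R) (T : F -> set E) : set (F * E) :=
  [set p | fitzT pair T p.1 p.2 \is a fin_num].

Definition IplusTS_range (S : E -> set F) (T : F -> set E) : set E :=
  [set z | exists x y t, S x y /\ T y t /\ z = x + t].
End Duality.

(* Main.v *)
Require Import Defs.
From HB Require Import structures.
From mathcomp Require Import all_boot all_order all_algebra.
From mathcomp Require Import all_classical all_reals all_analysis.
From mathcomp Require Import ring lra.
Import Order.TTheory GRing.Theory Num.Theory.
Import numFieldNormedType.Exports.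
Local Open Scope classical_set_scope.
Local Open Scope ring_scope.

(** [z] lies in the range of [I + TS] iff [0] lies in the range of [A + B],
    where [A = S] and [B x = - T^-1 (z - x)] are both maximally monotone.  Since
    the Fitzpatrick functions dominate the pairing, [phi_A + psi >= 0] for
    [psi q = phi_B (q.1, - q.2)], and either domain hypothesis gives
    [dom phi_A - dom psi = E x F].  The Fenchel duality theorem
    in its Attouch-Brezis form (Baire's theorem for the boundedness of the
    infimal convolution near [0], Hahn-Banach for a subgradient there) then
    yields an affine continuous function between [- psi] and [phi_A]; by
    reflexivity its slope is a point [(a, b)], and maximality turns the two
    inequalities into [b \in A a] and [- b \in B a]. *)

(** * Sublinear functionals and a Hahn-Banach theorem for convex cones *)

Section HahnBanach.
Set Implicit Arguments.
Unset Strict Implicit.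
Context {R : realType} {V : lmodType R}.

Definition sublinear (p : V -> R) :=
  (forall x y, p (x + y) <= p x + p y) /\
  (forall t x, 0 < t -> p (t *: x) = t * p x).

(** [K] is a convex cone in [V * R] that meets every vertical line; the last condition is what
    bounds its vertical sections below. *)
Definition convex_cone_epi (K : V -> R -> Prop) :=
  [/\ forall x, exists r, K x r,
      forall x y r s, K x r -> K y s -> K (x + y) (r + s),
      forall t x r, 0 < t -> K x r -> K (t *: x) (t * r) &
      forall r, K 0 r -> 0 <= r].

Lemma sublinear0 (p : V -> R) : sublinear p -> p 0 = 0.
Proof.
move=> [_ pZ]; have := pZ 2 0 ltac:(lra).
by rewrite scaler0; lra.
Qed.

(** [q x] is the infimum of the section [K x], finite because adding a point of [K (- x)] lands over
    [0]. *)
Lemma convex_cone_epi_sublinear (K : V -> R -> Prop) : convex_cone_epi K ->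
  exists q, sublinear q /\ forall x r, K x r -> q x <= r.
Proof.
move=> [Kex KD KZ K0].
have Klb x : has_lbound (K x).
  have [s Ks] := Kex (- x); exists (- s) => r Kr.
  have := K0 (r + s); rewrite -(subrr x) => /(_ (KD _ _ _ _ Kr Ks)); lra.
pose q x := inf (K x).
have qle x r : K x r -> q x <= r by move=> Kr; exact: ge_inf.
have q_ge x c : (forall r, K x r -> c <= r) -> c <= q x.
  by move=> cle; apply: lb_le_inf; [exact: Kex|move=> r; exact: cle].
have qZ t x : 0 < t -> t * q x <= q (t *: x).
  move=> t0; apply: (q_ge) => r Kr.
  have ti0 : 0 < t^-1 by rewrite invr_gt0.
  have := KZ _ _ _ ti0 Kr; rewrite scalerA mulVf ?gt_eqF// scale1r => /qle.
  by rewrite mulrC ler_pdivlMr// mulrC.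
exists q; split=> //; split.
  move=> x y; rewrite -lerBlDl; apply: (q_ge) => s Ks.
  rewrite lerBlDl -lerBlDr; apply: (q_ge) => r Kr.
  by rewrite lerBlDr; exact/qle/KD.
move=> t x t0; apply/eqP; rewrite eq_le qZ// andbT.
have ti0 : 0 < t^-1 by rewrite invr_gt0.
have := qZ _ (t *: x) ti0; rewrite scalerA mulVf ?gt_eqF// scale1r.
by rewrite mulrC ler_pdivrMr// mulrC.
Qed.

(* A pointwise minimal sublinear functional [p] is linear: for each [y], the
   sublinear functional [x |-> inf_(t >= 0) p (x + t *: y) - t * p y] lies
   below [p], so equals it, which forces [p x + p y <= p (x + y)]. *)
Lemma minimal_sublinear_linear (p : V -> R) : sublinear p ->
  (forall q, sublinear q -> (forall x, q x <= p x) -> forall x, p x <= q x) ->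
  forall a u v, p (a *: u + v) = a * p u + p v.
Proof.
move=> psub pmin; have p0 := sublinear0 psub; have [pD pZ] := psub.
have pD' x y : p (x + y) = p x + p y.
  apply/eqP; rewrite eq_le pD/=.
  pose K x r := exists2 t, 0 <= t & p (x + t *: y) - t * p y <= r.
  have [q [qsub qK]] : exists q, sublinear q /\ forall x r, K x r -> q x <= r.
    apply: convex_cone_epi_sublinear; split.
    - by move=> u; exists (p u), 0; rewrite ?scale0r ?addr0 ?mul0r ?subr0.
    - move=> u v r s [t t0 ht] [t' t'0 ht']; exists (t + t'); first lra.
      have := pD (u + t *: y) (v + t' *: y); rewrite addrACA -scalerDl; lra.
    - move=> t u r t0 [t' t'0 ht]; exists (t * t').
        by rewrite mulr_ge0// ltW.
      rewrite -scalerA -scalerDr pZ// -mulrA -mulrBr; nra.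
    - move=> r [t]; rewrite le_eqVlt => /predU1P[<-|t0].
        by rewrite scale0r addr0 p0 mul0r subr0.
      by rewrite add0r pZ// subrr.
  have /pmin : forall u, q u <= p u.
    by move=> u; apply: qK; exists 0; rewrite ?scale0r ?addr0 ?mul0r ?subr0.
  move=> /(_ qsub x) pq; rewrite -lerBrDr (le_trans pq)//; apply: qK.
  by exists 1; rewrite ?scale1r ?mul1r.
have pN x : p (- x) = - p x by have := pD' x (- x); rewrite subrr p0; lra.
move=> a u v; rewrite pD'; congr (_ + _).
case: (ltrgt0P a) => [a0|a0|->]; [exact: pZ| |by rewrite scale0r mul0r].
rewrite -[a *: u]opprK -scaleNr pN pZ ?oppr_gt0//; lra.
Qed.

Lemma hahn_banach_cone (K : V -> R -> Prop) : convex_cone_epi K ->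
  exists L : V -> R, (forall a u v, L (a *: u + v) = a * L u + L v) /\
    forall x r, K x r -> L x <= r.
Proof.
move=> /convex_cone_epi_sublinear[q [qsub qK]].
pose T := {p : V -> R | sublinear p /\ forall x, p x <= q x}.
(* The order is reversed, so that Zorn's maximal element is pointwise minimal. *)
pose le (p1 p2 : T) := `[< forall x, sval p2 x <= sval p1 x >].
have q0 : T by exists q; split.
have [||||[p [psub pq]] pmin] := @Zorn T le.
- by move=> p; apply/asboolP.
- move=> p1 p2 p3 /asboolP h12 /asboolP h23; apply/asboolP => x.
  exact: le_trans (h23 x) (h12 x).
- move=> [p1 p1P] [p2 p2P] /asboolP/= h12 /asboolP/= h21.
  have p12 : p1 = p2 by apply/funext => x; apply/eqP; rewrite eq_le h12 h21.
  by case: _ / p12 p2P {h12 h21} => p2P; congr exist; exact: Prop_irrelevance.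
- move=> A Atot; have [[p0 Ap0]|A0] := pselect (exists p, A p); last first.
    by exists q0 => p Ap; case: A0; exists p.
  (* The union of the epigraphs is stable under sums because [A] is a chain; its lower envelope
     bounds the chain. *)
  pose C x r := exists2 p : T, A p & sval p x <= r.
  have [p [psub pC]] : exists q, sublinear q /\ forall x r, C x r -> q x <= r.
    apply: convex_cone_epi_sublinear; split.
    - by move=> x; exists (sval p0 x), p0.
    - move=> x y r s [p1 Ap1 h1] [p2 Ap2 h2].
      have [/asboolP h|/asboolP h] := Atot _ _ Ap1 Ap2.
        exists p2 => //; have := (proj1 (proj1 (svalP p2))) x y; have := h x.
        lra.
      exists p1 => //; have := (proj1 (proj1 (svalP p1))) x y; have := h y.
      lra.
    - move=> t x r t0 [p Ap h]; exists p => //.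
      by rewrite (proj2 (proj1 (svalP p)))// ler_pM2l.
    - by move=> r [p Ap]; rewrite (sublinear0 (proj1 (svalP p))).
  have pq x : p x <= q x.
    by apply: le_trans (proj2 (svalP p0) x); apply: pC; exists p0.
  exists (exist _ p (conj psub pq)) => p' Ap'; apply/asboolP => x /=.
  by apply: pC; exists p'.
exists p; split=> [|x r Kr]; last exact: le_trans (pq x) (qK _ _ Kr).
apply: minimal_sublinear_linear => // p' p'sub p'p.
have p'q x : p' x <= q x by exact: le_trans (p'p x) (pq x).
have := pmin (exist _ p' (conj p'sub p'q)) => /(_ _)/(congr1 sval)/= <-//.
exact/asboolP.
Qed.

End HahnBanach.

(** * From approximate to exact images of a bounded closed set *)

Section OpenMapping.
Set Implicit Arguments.
Unset Strict Implicit.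
Context {R : realType} {X : normedModType R} {Y : completeNormedModType R}.
Variable f : {linear Y -> X}.
Hypothesis f_cont : continuous f.

Definition midpoint_convex (V : lmodType R) (K : set V) :=
  forall y z, K y -> K z -> K (2^-1 *: (y + z)).

(* Zabreiko's argument: [d] is the sum of the series with terms
   [2 ^- n.+1 *: f (y n)], the [y n] being chosen in [K] so that the
   rescaled remainder [e n] stays in the ball of radius [delta]. *)
Lemma ball_sub_image (K : set Y) (M delta : R) :
  closed K -> midpoint_convex K -> K !=set0 -> (forall y, K y -> `|y| <= M) ->
  0 < delta ->
  (forall d e, `|d| < delta -> 0 < e -> exists2 y, K y & `|d - f y| < e) ->
  forall d, `|d| < delta / 2 -> exists2 y, K y & f y = d.
Proof.
move=> Kcl Kmid [y0 Ky0] KM delta0 Kapprox d d_small.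
have half_delta : 0 < delta / 2 by lra.
have approx e : exists y, `|e| < delta -> K y /\ `|e - f y| < delta / 2.
  have [e_small|] := pselect (`|e| < delta); last by exists y0.
  by have [y Ky ye] := Kapprox e _ e_small half_delta; exists y.
have [phi phiP] := choice approx.
(* Starting at [2 *: d] matches the weights [h ^+ n.+1], whose total is [1]. *)
pose e n := iter n (fun e => 2 *: (e - f (phi e))) (2 *: d).
have e_lt n : `|e n| < delta.
  elim: n => [|n IHn]; rewrite /e /= -?/(e n) normrZ gtr0_norm//.
    by rewrite mulrC -ltr_pdivlMr.
  by rewrite mulrC -ltr_pdivlMr// (phiP _ IHn).2.
have eS n : e n.+1 = 2 *: (e n - f (phi (e n))) by [].
pose h : R := 2^-1.
have h2 : h * 2 = 1 by rewrite /h; lra.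
pose u n : Y := h ^+ n.+1 *: phi (e n).
(* The weight [h ^+ n] still unspent goes to a point of [K], which makes the sum an iterated
   midpoint. *)
have Ku n y : K y -> K (series u n + h ^+ n *: y).
  elim: n y => [|n IHn] y Ky.
    by rewrite /series/= big_geq// add0r expr0 scale1r.
  rewrite seriesSr /u -addrA exprSr -!scalerA -scalerDr -scalerDr.
  exact/IHn/Kmid/Ky/(phiP _ (e_lt n)).1.
have du n : f (series u n) = d - h ^+ n.+1 *: e n.
  elim: n => [|n IHn].
    rewrite /series/= big_geq// linear0 expr1 /e /= scalerA h2 scale1r.
    by rewrite subrr.
  rewrite seriesSr linearD IHn eS /u [h ^+ n.+2]exprSr -scalerA [h *: _]scalerA.
  rewrite h2 scale1r scalerBr opprB [f (_ *: _)]linearZ_LR [in RHS]addrA.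
  by rewrite addrAC.
have hlt1 : `|h| < 1 by rewrite gtr0_norm ?/h; lra.
have geo c : (fun n => h ^+ n *: c) @ \oo --> (0 : Y).
  rewrite -[X in _ --> X](scale0r c); apply: cvgZr_tmp.
  exact: cvg_expr.
have M0 : 0 <= M by exact: le_trans (KM _ Ky0).
have h0 n : 0 <= h ^+ n by rewrite exprn_ge0// /h; lra.
have u_cvg : cvgn (series u).
  apply: normed_cvg; apply: (@series_le_cvg _ _ (geometric (h * M) h)).
  - by move=> n; rewrite normr_ge0.
  - by move=> n /=; rewrite !mulr_ge0// /h; lra.
  - move=> n /=; rewrite /u normrZ ger0_norm// exprS [h * M * _]mulrAC.
    rewrite ler_wpM2l//; first by rewrite mulr_ge0// /h; lra.
    exact/KM/(phiP _ (e_lt n)).1.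
  - exact: is_cvg_geometric_series.
move/cvg_ex : u_cvg => [l ul].
exists l.
  have : (fun n => series u n + h ^+ n *: y0) @ \oo --> l.
    rewrite -[l]addr0; apply: cvgD => //; exact: geo.
  apply: (closed_cvg _ Kcl) => //.
  by apply: nearW => n; exact: Ku.
have fl : (f \o series u) @ \oo --> f l.
  by apply: continuous_cvg => //; exact: f_cont.
have fd : (f \o series u) @ \oo --> d.
  rewrite (_ : _ \o _ = fun n => d - h ^+ n.+1 *: e n).
    rewrite -[X in _ --> X]subr0; apply: cvgB; first exact: cvg_cst.
    apply/cvgr0Pnorm_le => eps eps0; near=> n.
    rewrite normrZ ger0_norm// exprS -mulrA.
    have le_geo : h * (h ^+ n * `|e n|) <= `|delta * h ^+ n|.
      rewrite ger0_norm; last by rewrite mulr_ge0// ltW.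
      have := ler_wpM2l (h0 n) (ltW (e_lt n)).
      have := mulr_ge0 (h0 n) (normr_ge0 (e n)).
      rewrite /h; lra.
    apply: le_trans le_geo _; near: n.
    exact: cvgr0_norm_le (cvg_geometric delta hlt1) _ eps0.
  by apply/funext => n; rewrite -du.
exact: (cvg_unique _ fl fd).
Unshelve. all: by end_near. Qed.
End OpenMapping.

(** * Baire's theorem for an increasing cover by images *)

Section ConvexOpenMapping.
Set Implicit Arguments.
Unset Strict Implicit.
Context {R : realType} {X Y : completeNormedModType R}.
Variable f : {linear Y -> X}.
Hypothesis f_cont : continuous f.

Lemma ball_sub_image_cover (K : nat -> set Y) (M : nat -> R) :
  (forall n, closed (K n)) -> (forall n, midpoint_convex (K n)) ->
  (forall n m, (n <= m)%N -> K n `<=` K m) ->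
  (forall n y, K n y -> `|y| <= M n) ->
  (forall d, exists n, exists2 y, K n y & f y = d) ->
  exists n delta, 0 < delta /\
    forall d, `|d| < delta -> exists2 y, K n y & f y = d.
Proof.
move=> Kcl Kmid Kmon KM Kcover.
pose F n := ~` closure (f @` K n).
have Fopen n : open (F n) by apply: closed_openC; exact: closed_closure.
have [n Fn] : exists n, ~ dense (F n).
  apply: contrapT => /forallNP Fdense.
  have Fod n : open (F n) /\ dense (F n) by split; [|exact: contrapT].
  have := Baire Fod; move=> /(_ setT)[||x [_ Fx]].
  - by exists 0.
  - exact: openT.
  have [k [y Ky fy]] := Kcover x.
  by apply: (Fx k) => //; apply: subset_closure; exists y.
have [U [[x0 Ux0] Uopen UF]] :
    exists U, [/\ U !=set0, open U & U `<=` closure (f @` K n)].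
  move/existsNP : Fn => [U /not_implyP[U0 /not_implyP[Uopen UF]]].
  exists U; split=> // x Ux; apply: contrapT => Fx; apply: UF.
  by exists x.
have /nbhs_normP[rho /= rho0 rhoU] : nbhs x0 U by exact: open_nbhs_nbhs.
have [m [y1 Ky1 fy1]] := Kcover (- x0).
(* One halving comes from taking midpoints, the other from [ball_sub_image]. *)
pose N := maxn n m; exists N, (rho / 2 / 2).
split; first by rewrite !divr_gt0.
apply: (ball_sub_image f_cont (Kcl N) (Kmid N) _ (KM N)).
- by exists y1; apply: Kmon Ky1; exact: leq_maxr.
- lra.
move=> d e d_small e0.
have : closure (f @` K n) (x0 + 2 *: d).
  apply: UF; apply: rhoU => /=.
  rewrite opprD addNKr normrN normrZ gtr0_norm//; lra.
move=> /(_ (ball (x0 + 2 *: d) (2 * e)))[].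
  by apply: nbhsx_ballx; lra.
move=> _ [[y Ky <-]]; rewrite -ball_normE/= => ye.
exists (2^-1 *: (y + y1)).
  apply: Kmid; first by apply: Kmon Ky; exact: leq_maxl.
  by apply: Kmon Ky1; exact: leq_maxr.
rewrite linearZ_LR linearD fy1.
have -> : d - 2^-1 *: (f y - x0) = 2^-1 *: (x0 + 2 *: d - f y).
  rewrite !scalerBr scalerDr scalerA mulVf// scale1r opprB addrA.
  by rewrite [d + _]addrC.
rewrite normrZ gtr0_norm; last lra.
lra.
Qed.

End ConvexOpenMapping.

(** * Completeness of products *)

HB.instance Definition _ (U V : puniformType) := Pointed.on (U * V)%type.

Section Sandwich.
Set Implicit Arguments.
Unset Strict Implicit.
Context {R : realType}.

Lemma prod_complete (U V : completeNormedModType R) (G : set_system (U * V)) :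
  ProperFilter G -> cauchy G -> cvg G.
Proof.
move=> GF Gc.
have /cauchy_cvg/cvg_ex[l1 Gl1] : cauchy (fst @ G).
  apply/cauchyP => e e0; move/cauchyP : Gc => /(_ e e0)[x Gx]; exists x.1.
  suff : G [set y | ball x.1 e y.1] by [].
  apply: filterS Gx => y xy.
  by have [] : ball x.1 e y.1 /\ ball x.2 e y.2 := xy.
have /cauchy_cvg/cvg_ex[l2 Gl2] : cauchy (snd @ G).
  apply/cauchyP => e e0; move/cauchyP : Gc => /(_ e e0)[x Gx]; exists x.2.
  suff : G [set y | ball x.2 e y.2] by [].
  apply: filterS Gx => y xy.
  by have [] : ball x.1 e y.1 /\ ball x.2 e y.2 := xy.
apply/cvg_ex; exists (l1, l2); apply/cvg_ballP => e e0; near=> x.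
suff : ball l1 e x.1 /\ ball l2 e x.2 by [].
split.
- by near: x; move/cvg_ballP : Gl1; exact.
- by near: x; move/cvg_ballP : Gl2; exact.
Unshelve. all: by end_near. Qed.

HB.instance Definition _ (U V : completeNormedModType R) :=
  Uniform_isComplete.Build (U * V)%type (@prod_complete U V).

End Sandwich.

(** * Fenchel duality under the Attouch-Brezis condition *)

Section Sandwich.
Set Implicit Arguments.
Unset Strict Implicit.
Context {R : realType} {X : completeNormedModType R}.

(* [f p r] stands for [phi p <= r], where [phi] is a convex lower
   semicontinuous function with values in [-oo, +oo]. *)
Definition closed_convex_epi (f : X -> R -> Prop) :=
  [/\ forall a b p q r s, 0 <= a -> 0 <= b -> a + b = 1 ->
        f p r -> f q s -> f (a *: p + b *: q) (a * r + b * s),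
      forall p r s, r <= s -> f p r -> f p s &
      forall r, closed [set p | f p r]].

(** The ball is symmetric, so an upper bound for [L] there is also one for [- L]. *)
Lemma linear_upper_bounded_continuous (V : normedModType R) (L : V -> R)
    (delta M : R) :
  (forall a u v, L (a *: u + v) = a * L u + L v) -> 0 < delta ->
  (forall d, `|d| < delta -> L d <= M) -> cont_lin_functional L.
Proof.
move=> Llin delta0 LM; split=> //.
have LN u : L (- u) = - L u.
  have := Llin (-1) u u; rewrite scaleN1r addNr.
  have := Llin 1 0 0; rewrite scale1r addr0.
  have := Llin (-1) u 0; rewrite scaleN1r addr0.
  lra.
pose Lp : {linear V -> R^o} := HB.pack L (GRing.isLinear.Build _ _ _ _ L Llin).
suff : bounded_near Lp (nbhs 0) by exact: bounded_linear_continuous.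
rewrite /bounded_near; near=> B; near=> x => /=.
have x_small : `|x| < delta.
  near: x; apply/nbhs_normP; exists delta => // y /=.
  by rewrite sub0r normrN.
have MB : M <= B by near: B; apply: nbhs_pinfty_ge; exact: num_real.
suff LxM : `|L x| <= M by exact: le_trans LxM MB.
have := LM (- x); rewrite LN normrN => /(_ x_small) LN_le.
by rewrite ler_norml LM// andbT; lra.
Unshelve. all: by end_near. Qed.

(** This bounds the infimal convolution, the infimum of [r + s] over [p - q = d], above near [0].
    The pairs with norm and both values at most [n] form closed convex sets whose images under
    subtraction cover [X]. *)
Lemma sub_epi_bounded_above (f g : X -> R -> Prop) :
  closed_convex_epi f -> closed_convex_epi g ->
  (forall d, exists p q r s, [/\ f p r, g q s & d = p - q]) ->
  exists delta M : R, 0 < delta /\ forall d, `|d| < delta ->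
    exists p q r s, [/\ f p r, g q s, d = p - q & r + s <= M].
Proof.
move=> [f_cvx f_up f_cl] [g_cvx g_up g_cl] onto.
pose D (y : X * X) : X := y.1 - y.2.
have D_lin : linear D.
  by move=> a [u v] [u' v']; rewrite /D/= scalerBr opprD addrACA.
pose Dl : {linear (X * X)%type -> X} :=
  HB.pack D (GRing.isLinear.Build _ _ _ _ D D_lin).
have D_cont : continuous Dl.
  by move=> y; apply: cvgB; [exact: cvg_fst|exact: cvg_snd].
pose K n : set (X * X) := [set y | [/\ `|y| <= n%:R, f y.1 n%:R & g y.2 n%:R]].
have [|||||n [delta [delta0 nK]]] :=
  @ball_sub_image_cover _ _ _ Dl D_cont K (fun n => n%:R).
- move=> n.
  rewrite (_ : K n = [set y | `|y| <= n%:R] `&`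
    (fst @^-1` [set p | f p n%:R]) `&` (snd @^-1` [set p | g p n%:R])).
    apply: closedI; first apply: closedI.
    + apply: (@preimage_closed _ _ (fun y : X * X => `|y|) [set r | r <= n%:R]).
        by move=> y _; exact: norm_continuous.
      exact: closed_le.
    + by apply: preimage_closed => // y _; exact: cvg_fst.
    + by apply: preimage_closed => // y _; exact: cvg_snd.
  by apply/seteqP; split=> y; [case=> ? ? ?|case=> -[]].
- move=> n y z [y1 y2 y3] [z1 z2 z3].
  have h0 : (0 : R) <= 2^-1 by lra.
  have h1 : 2^-1 + 2^-1 = 1 :> R by lra.
  have hn : n%:R = 2^-1 * n%:R + 2^-1 * n%:R :> R by lra.
  split.
  + rewrite normrZ ger0_norm//; have := ler_normD y z; lra.
  + by rewrite hn /= scalerDr; exact: f_cvx.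
  + by rewrite hn /= scalerDr; exact: g_cvx.
- move=> n m nm y [y1 y2 y3].
  have nmR : n%:R <= m%:R :> R by rewrite ler_nat.
  by split; [exact: le_trans nmR|exact: f_up y2|exact: g_up y3].
- by move=> n y [].
- move=> d; have [p [q [r [s [fp gq ->]]]]] := onto d.
  have [n nle] : exists n : nat, `|(p, q)| + `|r| + `|s| <= n%:R.
    exists (Num.truncn (`|(p, q)| + `|r| + `|s|)).+1.
    exact/ltW/Num.Theory.truncnS_gt.
  have rle := ler_norm r; have sle := ler_norm s.
  have pq0 := normr_ge0 (p, q); have r0 := normr_ge0 r; have s0 := normr_ge0 s.
  exists n, (p, q) => //; split; first lra.
    by apply: f_up fp; lra.
  by apply: g_up gq; lra.
- exists delta, (n%:R + n%:R); split=> // d /nK[[p q] [_ fp gq] <-].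
  by exists p, q, n%:R, n%:R.
Qed.

(** The infimal convolution is nonnegative at [0], so the cone [K] generated by its epigraph
    satisfies [convex_cone_epi]. Hahn-Banach gives a linear [L] below it, continuous by the bound
    near [0]. *)
Lemma sandwich (f g : X -> R -> Prop) :
  closed_convex_epi f -> closed_convex_epi g ->
  (forall d, exists p q r s, [/\ f p r, g q s & d = p - q]) ->
  (forall p r s, f p r -> g p s -> 0 <= r + s) ->
  exists L c, cont_lin_functional L /\
    ((forall p r, f p r -> L p + c <= r) /\
     forall q s, g q s -> - L q - c <= s).
Proof.
move=> fepi gepi onto fg0.
have [delta [M [delta0 bnd]]] := sub_epi_bounded_above fepi gepi onto.
have [[f_cvx f_up f_cl] [g_cvx g_up g_cl]] := (fepi, gepi).
pose K d r := exists t p q a b,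
  [/\ 0 < t, f p a, g q b, d = t *: (p - q) & r = t * (a + b)].
have [|L [Llin LK]] := @hahn_banach_cone R X K.
  split.
  - move=> d; have [p [q [r [s [fp gq ->]]]]] := onto d.
    by exists (1 * (r + s)), 1, p, q, r, s; split; rewrite ?scale1r.
  - move=> d1 d2 r1 r2 [t [p [q [a [b [t0 fp gq -> ->]]]]]].
    move=> [t' [p' [q' [a' [b' [t'0 fp' gq' -> ->]]]]]].
    have tt'0 : 0 < t + t' by lra.
    have w1 : t / (t + t') + t' / (t + t') = 1 by rewrite -mulrDl divff ?gt_eqF.
    (* The sum of two cone elements is [t + t'] times a convex combination. *)
    exists (t + t'), (t / (t + t') *: p + t' / (t + t') *: p'),
      (t / (t + t') *: q + t' / (t + t') *: q'),
      (t / (t + t') * a + t' / (t + t') * a'),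
      (t / (t + t') * b + t' / (t + t') * b'); split=> //.
    + by apply: f_cvx => //; rewrite divr_ge0 ?ltW.
    + by apply: g_cvx => //; rewrite divr_ge0 ?ltW.
    + rewrite !scalerBr !scalerDr !scalerA ![(t + t') * (_ / _)]mulrCA.
      by rewrite divff ?gt_eqF// !mulr1 opprD addrACA.
    + by field; rewrite gt_eqF.
  - move=> t d1 r1 t0 [t' [p [q [a [b [t'0 fp gq -> ->]]]]]].
    exists (t * t'), p, q, a, b; split=> //; first by rewrite mulr_gt0.
      by rewrite scalerA.
    by rewrite mulrA.
  - move=> r1 [t [p [q [a [b [t0 fp gq + ->]]]]]] => /esym/eqP.
    rewrite scaler_eq0 gt_eqF//= subr_eq0 => /eqP pq.
    by apply: mulr_ge0; [exact: ltW|apply: (fg0 p); rewrite ?pq// -pq].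
have Lle p q r s : f p r -> g q s -> L p - L q <= r + s.
  move=> fp gq; have -> : L p - L q = L (p - q).
    by rewrite [p - q]addrC -[- q]scaleN1r Llin mulN1r addrC.
  by apply: LK; exists 1, p, q, r, s; split=> //; rewrite ?scale1r ?mul1r.
have [p0 [q0 [r0 [s0 [fp0 gq0 _]]]]] := onto 0.
(* [inf C] is the largest constant that keeps [L + c] below [f]; by [Lle], every [- L q - s] bounds
   [C] below. *)
pose C := [set c | exists p r, f p r /\ c = r - L p].
have C_lb : lbound C (- L q0 - s0).
  by move=> _ [p [r [fp ->]]]; have := Lle _ _ _ _ fp gq0; lra.
exists L, (inf C); split.
  apply: (linear_upper_bounded_continuous Llin delta0 (M := M)) => d.
  move=> /bnd[p [q [r [s [fp gq -> rsM]]]]].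
  apply: le_trans rsM; apply: LK; exists 1, p, q, r, s.
  by split; rewrite ?scale1r ?mul1r.
split=> [p r fp|q s gq].
  rewrite -lerBrDl; apply: ge_inf; first by exists (- L q0 - s0).
  by exists p, r.
suff : - L q - s <= inf C by lra.
apply: lb_le_inf; first by exists (r0 - L p0), p0, r0.
by move=> _ [p [r [fp ->]]]; have := Lle _ _ _ _ fp gq; lra.
Qed.

End Sandwich.

(** * The duality pairing and completeness of the dual *)

Section Pairing.
Set Implicit Arguments.
Unset Strict Implicit.
Context {R : realType} {E F : normedModType R} {pair : E -> F -> R}.
Hypothesis Hdual : is_dual_pairing pair.

Lemma pairDl x x' y : pair (x + x') y = pair x y + pair x' y.
Proof. by have [+ _ _ _] := Hdual => /(_ 1 x x' y); rewrite scale1r mul1r. Qed.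

Lemma pairDr x y y' : pair x (y + y') = pair x y + pair x y'.
Proof. by have [_ + _ _] := Hdual => /(_ 1 x y y'); rewrite scale1r mul1r. Qed.

Lemma pair0l y : pair 0 y = 0.
Proof. by have := pairDl 0 0 y; rewrite addr0; lra. Qed.

Lemma pair0r x : pair x 0 = 0.
Proof. by have := pairDr x 0 0; rewrite addr0; lra. Qed.

Lemma pairZl a x y : pair (a *: x) y = a * pair x y.
Proof. by have [+ _ _ _] := Hdual => /(_ a x 0 y); rewrite pair0l !addr0. Qed.

Lemma pairZr a x y : pair x (a *: y) = a * pair x y.
Proof. by have [_ + _ _] := Hdual => /(_ a x y 0); rewrite pair0r !addr0. Qed.

Lemma pairNl x y : pair (- x) y = - pair x y.
Proof. by rewrite -scaleN1r pairZl mulN1r. Qed.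

Lemma pairNr x y : pair x (- y) = - pair x y.
Proof. by rewrite -scaleN1r pairZr mulN1r. Qed.

(* The supremum defining [`|y|] is not known to be finite: if it were not,
   the junk value [sup _ = 0] would give [y = 0], hence [pair x y = 0]. *)
Lemma ler_pair x y : `|pair x y| <= `|x| * `|y|.
Proof.
have [x0|x_neq0] := eqVneq x 0; first by rewrite x0 pair0l !normr0 mul0r.
have nx0 : 0 < `|x| by rewrite normr_gt0.
pose A := [set `|pair x y| | x in [set x : E | `|x| <= 1]].
have yA : `|y| = sup A by have [_ _ _ ->] := Hdual.
have [A_ub|A_nub] := pselect (has_ubound A); last first.
  have : `|y| = 0.
    by rewrite yA sup_out// => -[].
  by move=> /normr0_eq0 ->; rewrite pair0r !normr0 mulr0.
rewrite mulrC -ler_pdivrMr// yA; apply: ub_le_sup => //.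
exists (`|x|^-1 *: x) => /=.
  by rewrite normrZ gtr0_norm ?invr_gt0// mulVf ?gt_eqF.
by rewrite pairZl normrM gtr0_norm ?invr_gt0// mulrC.
Qed.

Lemma pair_norm_le y c : (forall x, `|x| <= 1 -> `|pair x y| <= c) -> `|y| <= c.
Proof.
move=> yc; have [_ _ _ ->] := Hdual; apply: ge_sup.
  by exists `|pair 0 y|; exists 0 => //=; rewrite normr0.
by move=> _ [x /= x1 <-]; exact: yc.
Qed.

Lemma pair_continuousl y : continuous (pair^~ y).
Proof.
apply: (proj2 (linear_upper_bounded_continuous (delta := 1) (M := `|y|)
  _ _ _)) => //.
  by move=> a u v; rewrite pairDl pairZl.
move=> d d1; apply: le_trans (ler_norm _) _; apply: le_trans (ler_pair _ _) _.
by rewrite ler_piMl// ltW.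
Qed.

Lemma pair_continuousr x : continuous (pair x).
Proof.
apply: (proj2 (linear_upper_bounded_continuous (delta := 1) (M := `|x|)
  _ _ _)) => //.
  by move=> a u v; rewrite pairDr pairZr.
move=> d d1; apply: le_trans (ler_norm _) _; apply: le_trans (ler_pair _ _) _.
by rewrite ler_piMr// ltW.
Qed.

(** The pointwise limit [l] along [G] is linear and bounded on the unit ball, hence represented by
    some [y]; the estimate [lB], uniform on that ball, upgrades this to norm convergence. *)
Lemma dual_complete (G : set_system F) : ProperFilter G -> cauchy G -> cvg G.
Proof.
move=> GF /cauchyP Gc.
have Gx x : cvg (pair x @ G).
  apply: R_complete; apply/cauchyP => e e0.
  (* The [+ 1] covers the case [x = 0]. *)
  have e'0 : 0 < e / (`|x| + 1) by rewrite divr_gt0// ltr_wpDl.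
  have [y Gy] := Gc _ e'0; exists (pair x y).
  suff : G [set y' | ball (pair x y) e (pair x y')] by [].
  apply: filterS Gy => y'; rewrite -!ball_normE/= => yy'.
  rewrite -pairNr -pairDr; apply: le_lt_trans (ler_pair _ _) _.
  move: yy'; rewrite ltr_pdivlMr ?ltr_wpDl// => yy'.
  have := normr_ge0 (y - y'); lra.
pose l x : R := lim (pair x @ G).
have Gl x : pair x @ G --> l x by exact: Gx.
have lB y e x : G (ball y e) -> `|pair x y - l x| <= `|x| * e.
  move=> Gye.
  have lim_dist : (fun y' => `|pair x y - pair x y'|) @ G --> `|pair x y - l x|.
    by apply: cvg_norm; apply: cvgB; [exact: cvg_cst|exact: Gl].
  apply: (closed_cvg (fun r : R => r <= `|x| * e)) lim_dist.
    exact: closed_le.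
  apply: filterS Gye => y'; rewrite -ball_normE/= => yy'.
  rewrite -pairNr -pairDr; apply: le_trans (ler_pair _ _) _.
  by rewrite ler_wpM2l// ltW.
have l_lin a u v : l (a *: u + v) = a * l u + l v.
  have Glin : pair (a *: u + v) @ G --> a * l u + l v.
    rewrite (_ : pair _ = fun y => a * pair u y + pair v y).
      by apply: cvgD; [apply: cvgM; [exact: cvg_cst|exact: Gl]|exact: Gl].
    by apply/funext => y; rewrite pairDl pairZl.
  exact: (cvg_unique _ (Gl _) Glin).
have [y1 Gy1] := Gc 1 ltr01.
have [_ _ repr _] := Hdual.
have [|y [ly _]] := repr l.
  apply: (linear_upper_bounded_continuous (delta := 1) (M := `|y1| + 1)) => //.
  move=> d d1.
  have := lB y1 1 d Gy1; have := ler_pair d y1; have := normr_ge0 y1.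
  rewrite !ler_norml; nra.
apply/cvg_ex; exists y; apply/cvgrPdist_le => e e0.
have e2 : 0 < e / 2 by lra.
have [y2 Gy2] := Gc _ e2.
apply: filterS (Gy2) => y'; rewrite -ball_normE/= => yy'.
rewrite -(subrKA y2); apply: le_trans (ler_normD _ _) _.
suff : `|y - y2| <= e / 2 by lra.
apply: pair_norm_le => x x1; rewrite pairDr pairNr -ly distrC.
by apply: le_trans (lB _ _ _ Gy2) _; rewrite ler_piMl// ltW.
Qed.

End Pairing.

(** * Fitzpatrick functions and a zero of the sum of two monotone operators *)

Section SumZero.
Set Implicit Arguments.
Unset Strict Implicit.
Context {R : realType} {E F : completeNormedModType R} {pair : E -> F -> R}.
Hypotheses (Hdual : is_dual_pairing pair) (Hrefl : reflexive_pairing pair).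

(** Epigraph of a supremum of affine functions, a form shared by [phi_A] and the reflected [psi]. *)
Definition sup_affine_le (I : Type) (D : set I) (a : I -> E) (b : I -> F)
    (k : I -> R) (p : E * F) (r : R) :=
  forall i, D i -> pair p.1 (b i) + pair (a i) p.2 - k i <= r.

Lemma sup_affine_closed_convex I D a b k :
  closed_convex_epi (@sup_affine_le I D a b k).
Proof.
split.
- move=> c d [x u] [y v] r s c0 d0 cd1 xur yvs i Di.
  rewrite /= (pairDl Hdual) (pairDr Hdual) !(pairZl Hdual) !(pairZr Hdual).
  have := xur i Di; have := yvs i Di => /= yvs' xur'.
  have := ler_wpM2l c0 xur'; have := ler_wpM2l d0 yvs'.
  have : c * k i + d * k i = k i by rewrite -mulrDl cd1 mul1r.
  lra.
- by move=> p r s rs pr i Di; exact: le_trans (pr i Di) rs.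
- move=> r; rewrite (_ : [set _ | _] = \bigcap_(i in D)
    [set p | pair p.1 (b i) + pair (a i) p.2 - k i <= r]); last first.
    by apply/seteqP; split.
  apply: closed_bigI => i Di.
  apply: (@preimage_closed _ _
    (fun p : E * F => pair p.1 (b i) + pair (a i) p.2 - k i)
    [set x | x <= r]); last exact: closed_le.
  move=> p _; apply: cvgB; last exact: cvg_cst.
  apply: cvgD.
  + apply: (@continuous_comp _ _ _ fst (pair^~ (b i))); first exact: cvg_fst.
    exact: pair_continuousl.
  + apply: (@continuous_comp _ _ _ snd (pair (a i))); first exact: cvg_snd.
    exact: pair_continuousr.
Qed.

(** This encodes [phi_A p <= r] without extended reals. *)
Definition fitz_le (A : E -> set F) (p : E * F) (r : R) :=
  forall s s', A s s' -> pair p.1 s' + pair s p.2 - pair s s' <= r.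

Lemma pairBB x u s s' :
  pair (x - s) (u - s') = pair x u - pair x s' - pair s u + pair s s'.
Proof.
rewrite (pairDl Hdual) !(pairDr Hdual) !(pairNl Hdual) !(pairNr Hdual); lra.
Qed.

(** Adjoining [(x, u)] keeps the graph monotone, so maximality already contains it. *)
Lemma max_monotone_mem (A : E -> set F) x u : max_monotoneS pair A ->
  (forall s s', A s s' -> 0 <= pair (x - s) (u - s')) -> A x u.
Proof.
move=> [Amono Amax] xu.
apply: (Amax (fun s s' => A s s' \/ (s = x /\ s' = u))).
- move=> s1 s2 s1' s2' [As1|[-> ->]] [As2|[-> ->]].
  + exact: Amono.
  + have := xu _ _ As1; rewrite !pairBB; lra.
  + exact: xu.
  + by rewrite !subrr (pair0l Hdual).
- by left.
- by right.
Qed.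

(** If [r] were smaller, [p] would be monotonically related to the graph, hence in it; testing the
    bound at [p] itself is then contradictory. *)
Lemma fitz_ge_pair (A : E -> set F) p r :
  max_monotoneS pair A -> fitz_le A p r -> pair p.1 p.2 <= r.
Proof.
move=> Amax pr; rewrite leNgt; apply/negP => r_lt.
have Ap : A p.1 p.2.
  apply: max_monotone_mem Amax _ => s s' /pr; rewrite pairBB; lra.
have := pr _ _ Ap; lra.
Qed.

Lemma fitz_graph (A : E -> set F) s s' :
  monotoneS pair A -> A s s' -> fitz_le A (s, s') (pair s s').
Proof.
move=> Amono As t t' At /=.
by have := Amono _ _ _ _ As At; rewrite pairBB; lra.
Qed.

(** Restrict [L] to each factor: duality represents the part on [E], reflexivity the part on [F]. *)
Lemma continuous_functional_prod (L : E * F -> R) : cont_lin_functional L ->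
  exists a b, forall p, L p = pair p.1 b + pair a p.2.
Proof.
move=> [Llin Lcont]; have [_ _ repr _] := Hdual.
have L0 : L 0 = 0 by have := Llin 1 0 0; rewrite scale1r addr0; lra.
have [|b [Lb _]] := repr (fun x => L (x, 0)).
  split.
    move=> c u v; rewrite -Llin; congr L.
    by apply: injective_projections; rewrite /= ?scaler0 ?addr0.
  move=> x; apply: (@continuous_comp _ _ _ (fun x => (x, 0)) L); last first.
    exact: Lcont.
  by apply: cvg_pair; [exact: cvg_id|exact: cvg_cst].
have [|a La] := Hrefl (g := fun u => L (0, u)).
  split.
    move=> c u v; rewrite -Llin; congr L.
    by apply: injective_projections; rewrite /= ?scaler0 ?addr0.
  move=> x; apply: (@continuous_comp _ _ _ (fun u => (0, u)) L); last first.
    exact: Lcont.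
  by apply: cvg_pair; [exact: cvg_cst|exact: cvg_id].
exists a, b => -[x u] /=; rewrite -Lb -La.
have := Llin 1 (x, 0) (0, u); rewrite scale1r mul1r => <-.
by congr L; apply: injective_projections; rewrite /= ?addr0 ?add0r.
Qed.

(* With [phi_A], [phi_B] the Fitzpatrick functions, [L = <., b> + <a, .>]
   separates [phi_A (x, u)] from [- phi_B (x, - u)] and the constant [c] tells
   which of the two inclusions [A a b], [B a (- b)] holds first. *)
Lemma max_monotone_sum_zero (A B : E -> set F) :
  max_monotoneS pair A -> max_monotoneS pair B ->
  (forall x u, exists p q r s,
    [/\ fitz_le A p r, fitz_le B q s, x = p.1 - q.1 & u = p.2 + q.2]) ->
  exists x u, A x u /\ B x (- u).
Proof.
move=> Amax Bmax dom.
pose f : E * F -> R -> Prop := @sup_affine_le (E * F)%type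
  [set i | A i.1 i.2] fst snd (fun i => pair i.1 i.2).
(* The reflection of the second variable is moved onto the coefficient [- i.1]. *)
pose g : E * F -> R -> Prop := @sup_affine_le (E * F)%type
  [set i | B i.1 i.2] (fun i => - i.1) snd (fun i => pair i.1 i.2).
have fE p r : f p r <-> fitz_le A p r.
  by split=> [pr s s' /(pr (s, s'))//|pr [s s'] /=]; exact: pr.
have gE p r : g p r <-> fitz_le B (p.1, - p.2) r.
  split=> [pr s s' /(pr (s, s'))/=|pr [s s'] /= Bs].
    by rewrite (pairNl Hdual) (pairNr Hdual).
  by have := pr _ _ Bs; rewrite /= (pairNl Hdual) (pairNr Hdual).
have [| | | |L [c [/continuous_functional_prod[a [b Lab]] [Lf Lg]]]] :=
  @sandwich R (E * F)%type f g.
- exact: sup_affine_closed_convex.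
- exact: sup_affine_closed_convex.
- move=> [x u]; have [p [q [r [s [pr qs -> ->]]]]] := dom x u.
  exists p, (q.1, - q.2), r, s; split.
  + exact/fE.
  + by apply/gE; rewrite /= opprK -surjective_pairing.
  + by apply: injective_projections; rewrite /= ?opprK.
- move=> p r s /fE/(fitz_ge_pair Amax) pr /gE/(fitz_ge_pair Bmax).
  by rewrite /= (pairNr Hdual); lra.
(* On the graph [phi_A] is at most the pairing, so the affine minorant is too; completing the
   product gives this form. *)
have Ale s s' : A s s' -> c + pair a b <= pair (a - s) (b - s').
  move=> As; have /fE/Lf := fitz_graph (proj1 Amax) As.
  by rewrite Lab pairBB/=; lra.
have Ble s s' : B s s' -> - (c + pair a b) <= pair (a - s) (- b - s').
  move=> Bs; have := fitz_graph (proj1 Bmax) Bs.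
  rewrite -{1}[s']opprK => /(gE (s, - s'))/Lg.
  rewrite Lab pairBB/= !(pairNr Hdual); lra.
have Amem : 0 <= c + pair a b -> A a b.
  by move=> c0; apply: max_monotone_mem Amax _ => s s' /Ale; exact: le_trans.
have Bmem : c + pair a b <= 0 -> B a (- b).
  move=> c0; apply: max_monotone_mem Bmax _ => s s' /Ble; apply: le_trans.
  by rewrite oppr_ge0.
exists a, b; have [c0|c0] := lerP 0 (c + pair a b).
(* Testing [Ale] at [(a, b)] itself gives the opposite sign, hence the other inclusion. *)
- have Aa := Amem c0; split=> //; apply: Bmem.
  by have := Ale _ _ Aa; rewrite !subrr (pair0l Hdual).
- have Ba := Bmem (ltW c0); split=> //; apply: Amem.
  by have := Ble _ _ Ba; rewrite !subrr (pair0l Hdual); lra.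
Qed.

End SumZero.

(** * The range of [I + TS] *)

Section Hammerstein.
Set Implicit Arguments.
Unset Strict Implicit.
Context {R : realType}.

Lemma domS_fitz_le (E F : normedModType R) (pair : E -> F -> R) S x u :
  domS pair S (x, u) ->
  exists r, forall s s', S s s' -> pair x s' + pair s u - pair s s' <= r.
Proof.
move=> fin; exists (fine (fitzS pair S x u)) => s s' Ss.
by rewrite -lee_fin fineK//; apply: ereal_sup_ubound; exists (s, s').
Qed.

Lemma domT_fitz_le (E F : normedModType R) (pair : E -> F -> R) T u x :
  domT pair T (u, x) ->
  exists r, forall t' t, T t' t -> pair x t' + pair t u - pair t t' <= r.
Proof.
move=> fin; exists (fine (fitzT pair T u x)) => t' t Tt.
by rewrite -lee_fin fineK//; apply: ereal_sup_ubound; exists (t', t).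
Qed.

Context {E : completeNormedModType R}.

(** Both differences change sign, so the pairing is preserved; an extension is carried back to one
    of [T] by the inverse substitution. *)
Lemma reflected_inverse_max_monotone (F : normedModType R) (pair : E -> F -> R)
    (T : F -> set E) (z : E) :
  is_dual_pairing pair -> max_monotoneT pair T ->
  max_monotoneS pair (fun x v => T (- v) (z - x)).
Proof.
move=> Hdual [Tmono Tmax]; split=> [x1 x2 v1 v2 T1 T2|].
  have := Tmono _ _ _ _ T1 T2.
  by rewrite !(pairDl Hdual, pairDr Hdual, pairNl Hdual, pairNr Hdual); lra.
move=> V' V'mono V'ext x v V'xv.
apply: (Tmax (fun y t => V' (z - t) (- y))).
- move=> y1 y2 t1 t2 V1 V2; have := V'mono _ _ _ _ V1 V2.
  by rewrite !(pairDl Hdual, pairDr Hdual, pairNl Hdual, pairNr Hdual); lra.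
- by move=> y t Tyt; apply: V'ext; rewrite opprK subKr.
- by rewrite opprK subKr.
Qed.

Lemma hammerstein_range (F : completeNormedModType R) (pair : E -> F -> R)
  (Hdual : is_dual_pairing pair) (Hrefl : reflexive_pairing pair)
  (S : E -> set F) (T : F -> set E)
  (HS : max_monotoneS pair S) (HT : max_monotoneT pair T)
  (Hcases :
     ((forall xs : F, exists x : E, domT pair T (xs, x)) /\
        exists ws : F, forall x : E, domS pair S (x, ws))
     \/
     ((forall x : E, exists xs : F, domS pair S (x, xs)) /\
        exists w : E, forall xs : F, domT pair T (xs, w))) :
  IplusTS_range S T = [set: E].
Proof.
apply/seteqP; split=> // z _.
pose V : E -> set F := fun x v => T (- v) (z - x).
have Vdom v x : domT pair T (- v, z - x) ->
    exists r, fitz_le (pair := pair) V (x, v) r.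
  (* Expanding shows that [phi_V (x, v)] is [phi_T (- v, z - x) + pair z v]. *)
  move=> /domT_fitz_le[r Tr]; exists (r + pair z v) => s s' /Tr /=.
  rewrite !(pairDl Hdual) !(pairNl Hdual) !(pairNr Hdual); lra.
have Sdom x u : domS pair S (x, u) ->
    exists r, fitz_le (pair := pair) S (x, u) r.
  by move=> /domS_fitz_le[r Sr]; exists r.
have [a [b]] : exists a b, S a b /\ V a (- b).
  apply: (max_monotone_sum_zero Hdual Hrefl HS
    (reflected_inverse_max_monotone z Hdual HT)).
  move=> x u; case: Hcases => [[domT_all [w domS_w]]|[domS_all [w domT_w]]].
  (* Here [p.2 = w] is fixed, which determines [q.2]; [domT_all] then supplies [q.1], and [p.1] is
     unrestricted. *)
  - have [e Te] := domT_all (- (u - w)).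
    have [|s Vs] := Vdom (u - w) (z - e); first by rewrite subKr.
    have [r Sr] := Sdom _ _ (domS_w (x + (z - e))).
    exists (x + (z - e), w), (z - e, u - w), r, s.
    by split=> //=; rewrite ?addrK// addrC subrK.
  (* Here [q.1 = z - w] is fixed, which determines [p.1]; [domS_all] then supplies [p.2], and [q.2]
     is unrestricted. *)
  - have [u' Su'] := domS_all (x + (z - w)); have [r Sr] := Sdom _ _ Su'.
    have [|s Vs] := Vdom (u - u') (z - w); first by rewrite subKr.
    exists (x + (z - w), u'), (z - w, u - u'), r, s.
    by split=> //=; rewrite ?addrK// addrC subrK.
rewrite /V opprK => -[Sab Tb].
by exists a, b, (z - a); split=> //; split=> //; rewrite addrC subrK.
Qed.

End Hammerstein.

Theorem theorem7p6 (R : realType) (E : completeNormedModType R)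
  (F : normedModType R) (pair : E -> F -> R)
  (Hdual : is_dual_pairing pair) (Hrefl : reflexive_pairing pair)
  (Hnz : exists x : E, x != 0)
  (S : E -> set F) (T : F -> set E)
  (HS : max_monotoneS pair S) (HT : max_monotoneT pair T)
  (Hcases :
     ((forall xs : F, exists x : E, domT pair T (xs, x)) /\
        exists ws : F, forall x : E, domS pair S (x, ws))
     \/
     ((forall x : E, exists xs : F, domS pair S (x, xs)) /\
        exists w : E, forall xs : F, domT pair T (xs, w))) :
  IplusTS_range S T = [set: E].
Proof.
(* As a dual space [F] is complete, which Baire's theorem on products with [F] requires. *)
pose Fc : completeNormedModType R :=
  HB.pack (NormedModule.sort F)
    (Uniform_isComplete.Build F (dual_complete Hdual)).
exact: (@hammerstein_range R E Fc pair Hdual Hrefl S T HS HT Hcases).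
Qed.
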